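(* Let $V$ be an arbitrary vector space over a field $k$. The binary relation $\leq^{GD1}$ is a partial order (reflexive, antisymmetric and transitive) on the set of finite potent endomorphisms of $V$.
   Context: $k$ is an arbitrary field, $V$ an arbitrary (possibly infinite-dimensional) $k$-vector space. An endomorphism $\varphi\in\mathrm{End}_k(V)$ is finite potent if $\varphi^n(V)$ is finite dimensional for some $n\ge 1$. For such $\varphi$ there is a unique $\varphi$-invariant decomposition $V=W_\varphi\oplus U_\varphi$ (the AST decomposition) with $W_\varphi$ finite dimensional, $\varphi|_{W_\varphi}$ an automorphism of $W_\varphi$, and $\varphi|_{U_\varphi}$ nilpotent; the index $m=i(\varphi)$ is the nilpotency order of $\varphi|_{U_\varphi}$ ($i(\varphi)=0$ iff $V$ is finite dimensional and $\varphi$ is an automorphism). A $\{1\}$-inverse of $\varphi$ is $\varphi^-\in\mathrm{End}_k(V)$ with $\varphi\varphi^-\varphi=\varphi$; the set of them is $X_\varphi(1)$. A G-Drazin inverse of $\varphi$ is $\varphi^{GD}\in\mathrm{End}_k(V)$ with $\varphi\varphi^{GD}\varphi=\varphi$ and $\varphi^{GD}\varphi^m=\varphi^m\varphi^{GD}$; the set of them is $X_\varphi(GD)$. $X_\varphi(GD1)$ is the set of GD1 inverses of $\varphi$: those $\chi\in\mathrm{End}_k(V)$ such that $\chi\varphi\chi=\chi$, $\chi\varphi=\varphi^{GD}\varphi$ and $\varphi\chi=\varphi\varphi^-$ for some $\varphi^-\in X_\varphi(1)$, $\varphi^{GD}\in X_\varphi(GD)$. For finite potent $\varphi,\psi\in\mathrm{End}_k(V)$: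 $\varphi\leq^{GD1}\psi$ means that there are $\hat\varphi^{GD1},\tilde\varphi^{GD1}\in X_\varphi(GD1)$ with $\varphi\hat\varphi^{GD1}=\psi\hat\varphi^{GD1}$ and $\tilde\varphi^{GD1}\varphi=\tilde\varphi^{GD1}\psi$. *)

(* Defs.v *)
From HB Require Import structures.
From mathcomp Require Import all_boot all_order all_algebra.
From mathcomp Require Import boolp classical_sets functions.

Set Implicit Arguments.
Unset Strict Implicit.
Unset Printing Implicit Defensive.

Import GRing.Theory.
Local Open Scope classical_set_scope.
Local Open Scope ring_scope.

Section GD1Order.
Variables (k : fieldType) (V : lmodType k).
Implicit Types (phi psi chi : {linear V -> V}) (W U A : set V).

Definition fin_dim A : Prop :=
  exists (n : nat) (e : 'I_n -> V),
    A = [set v | exists c : 'I_n -> k, v = \sum_(i < n) c i *: e i].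

Definition finite_potent phi : Prop :=
  exists n : nat, (1 <= n)%N /\ fin_dim (range (iter n phi)).

Definition direct_sum W U : Prop :=
  [/\ submod_closed [in W], submod_closed [in U], W `&` U = [set 0] &
      forall v, exists w u, [/\ W w, U u & v = w + u]].

Definition vanishes_on phi U (n : nat) : Prop :=
  forall u, U u -> iter n phi u = 0.

(* [set_bij W W phi] includes the invariance of [W]. *)
Definition AST_decomposition phi W U : Prop :=
  [/\ direct_sum W U, fin_dim W, set_bij W W phi,
      (forall u, U u -> U (phi u)) & exists n, vanishes_on phi U n].

(* The nilpotency order may be 0: this happens exactly when [U] is zero.
   The AST decomposition of a finite potent endomorphism exists and is unique,
   so such an endomorphism has exactly one index. *)
Definition is_index phi (m : nat) : Prop :=
  exists W U, [/\ AST_decomposition phi W U, vanishes_on phi U m &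
                  forall n, vanishes_on phi U n -> (m <= n)%N].

Definition inv1 phi : set {linear V -> V} :=
  [set chi : {linear V -> V} | phi \o chi \o phi =1 phi].

Definition invGD phi : set {linear V -> V} :=
  [set chi : {linear V -> V} | phi \o chi \o phi =1 phi /\
     exists2 m, is_index phi m & chi \o iter m phi =1 iter m phi \o chi].

Definition invGD1 phi : set {linear V -> V} :=
  [set chi : {linear V -> V} | chi \o phi \o chi =1 chi /\
     exists2 phi1, inv1 phi phi1 & exists2 phiGD, invGD phi phiGD &
       chi \o phi =1 phiGD \o phi /\ phi \o chi =1 phi \o phi1].

Definition leGD1 phi psi : Prop :=
  (exists2 chi, invGD1 phi chi & phi \o chi =1 psi \o chi) /\
  (exists2 chi, invGD1 phi chi & chi \o phi =1 chi \o psi).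

End GD1Order.

(* Main.v *)
(** [phi <=GD1 psi] holds iff [phi] lies below [psi] in the minus order (some
    reflexive inner inverse [chi] of [phi] has [phi chi = psi chi] and
    [chi phi = chi psi]) and [psi] agrees with [phi] on the core [W_phi],
    that is [psi phi^n = phi^(n+1)] for some [n].  Antisymmetry already holds
    for the minus order.  Both conditions are transitive: the first by taking
    [eta phi eta], where [eta] witnesses [psi <= theta]; the second because
    [phi^(n+m) = psi^n phi^m] once [psi phi^m = phi^(m+1)]. *)

Require Import Defs.
From HB Require Import structures.
From mathcomp Require Import all_boot all_order all_algebra.
From mathcomp Require Import boolp classical_sets functions.

Set Implicit Arguments.
Unset Strict Implicit.
Unset Printing Implicit Defensive.

Import GRing.Theory.

Section LinearAlgebra.
Local Open Scope classical_set_scope.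
Local Open Scope ring_scope.
Variables (k : fieldType) (V : lmodType k).
Implicit Types (phi psi chi : {linear V -> V}) (W U A : set V).

(** * Linear maps and their iterates *)

Lemma linear_funext phi psi : phi =1 psi -> phi = psi.
Proof.
case: phi psi => [f [[f1] [f2]]] [g [[g1] [g2]]] /= /funext fg.
rewrite /= in fg; case: _ / fg in g1 g2 *.
by rewrite (Prop_irrelevance f1 g1) (Prop_irrelevance f2 g2).
Qed.

Lemma iter_linear phi n : linear (iter n phi).
Proof. by elim: n => [|n IHn] a u v //=; rewrite IHn linearP. Qed.

Lemma iter_linearD phi n u v : iter n phi (u + v) = iter n phi u + iter n phi v.
Proof. by have := iter_linear phi n 1 u v; rewrite !scale1r. Qed.

Lemma iter_linear0 phi n : iter n phi 0 = 0.
Proof. by elim: n => //= n ->; rewrite linear0. Qed.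

Lemma iter_linearB phi n u v : iter n phi (u - v) = iter n phi u - iter n phi v.
Proof. by apply/eqP; rewrite eq_sym subr_eq -iter_linearD subrK. Qed.

(** A linear relation with trivial fibre over [0] is single-valued, so any choice function for it is
    linear. *)
Lemma linear_choice (R : V -> V -> Prop) :
  (forall a x y u v, R x u -> R y v -> R (a *: x + y) (a *: u + v)) ->
  (forall x, exists u, R x u) -> (forall u, R 0 u -> u = 0) ->
  exists f : {linear V -> V}, forall x, R x (f x).
Proof.
move=> Rlin Rtot R0; have [f Rf] := choice Rtot.
have flin : linear f.
  move=> a x y; apply/eqP; rewrite -subr_eq0; apply/eqP/R0.
  have := Rlin (-1) _ _ _ _ (Rlin a _ _ _ _ (Rf x) (Rf y)) (Rf (a *: x + y)).
  by rewrite !scaleN1r addNr [- _ + _]addrC.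
pose fM := GRing.isLinear.Build k V V *:%R f flin.
exists (HB.pack_for {linear V -> V} f fM); exact: Rf.
Qed.

(** * Submodules, complements and inner inverses *)

Lemma submod_closedP A : submod_closed [in A] <->
  A 0 /\ forall a u v, A u -> A v -> A (a *: u + v).
Proof.
split=> -[A0 Alin]; split.
- exact: set_mem.
- by move=> a u v Au Av; apply/set_mem/Alin; apply: mem_set.
- exact: mem_set.
- by move=> a u v Au Av; apply/mem_set/Alin; apply: set_mem.
Qed.

Lemma submod_closedB A u v : submod_closed [in A] -> A u -> A v -> A (u - v).
Proof.
by move=> /submod_closedP[_ Alin] Au Av; rewrite addrC -scaleN1r; exact: Alin.
Qed.

Lemma submod_closedD A u v : submod_closed [in A] -> A u -> A v -> A (u + v).
Proof.
by move=> /submod_closedP[_ Alin] Au Av; rewrite -[u]scale1r; exact: Alin.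
Qed.

Lemma submod_complement A : submod_closed [in A] -> exists B, direct_sum A B.
Proof.
move=> Amod; have [A0 Alin] := (submod_closedP A).1 Amod.
(* [P] does not ask for [0] in [B], so that the union of an empty chain satisfies it; maximality
   yields [B 0] afterwards. *)
pose P (B : set V) := (forall a u v, B u -> B v -> B (a *: u + v)) /\
  forall u, A u -> B u -> u = 0.
have [F FP Ftot|B [[Blin BA] Bmax]] := @Zorn_bigcup V P.
  split=> [a u v [X FX Xu] [Y FY Yv]|u Au [X FX Xu]]; last first.
    exact: (FP _ FX).2.
  have [XY|YX] := Ftot _ _ FX FY.
    by exists Y => //; apply: (FP _ FY).1 => //; exact: XY.
  by exists X => //; apply: (FP _ FX).1 => //; exact: YX.
have Bext C : B `<=` C -> P C -> C `<=` B.
  move=> BC PC; apply: contrapT => CB; exact: (Bmax C (conj BC CB) PC).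
have B0 : B 0.
  apply: (Bext [set u | B u \/ u = 0]) => [u||]; [by left| |by right].
  split=> [a u v /= [Bu|->] [Bv|->]|u Au [/(BA u Au)//|//]].
  - by left; exact: Blin.
  - left; have -> : a *: u + 0 = (a - 1) *: u + u; last exact: Blin.
    by rewrite scalerBl scale1r subrK addr0.
  - by left; rewrite scaler0 add0r.
  - by right; rewrite scaler0 addr0.
exists B; split=> // [||v].
- exact/submod_closedP.
- by apply/seteqP; split=> [u [Au Bu]|u ->]; [exact: BA|split].
apply: contrapT => vAB; apply: (vAB).
(* As [v] is not in [A + B], the span [C] of [v] and [B] still meets [A] trivially; maximality then
   puts [v] in [B], a contradiction. *)
pose C := [set u | exists a b, B b /\ u = a *: v + b].
have CB : C `<=` B.
  apply: Bext => [b Bb|]; first by exists 0, b; rewrite scale0r add0r.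
  split=> [a _ _ [c [b [Bb ->]]] [c' [b' [Bb' ->]]]|u Au [a [b [Bb ub]]]].
    exists (a * c + c'), (a *: b + b'); split; first exact: Blin.
    by rewrite scalerDl scalerDr scalerA addrACA.
  have [a0|a0] := eqVneq a 0.
    by apply: BA => //; rewrite ub a0 scale0r add0r.
  case: vAB; exists (a^-1 *: u), (- a^-1 *: b); split.
  - by rewrite -[_ *: u]addr0; exact: Alin.
  - by rewrite -[_ *: b]addr0; exact: Blin.
  - by rewrite ub scalerDr scalerA mulVf// scale1r scaleNr addrK.
exists 0, v; split=> //; last by rewrite add0r.
by apply: CB; exists 1, 0; rewrite scale1r addr0.
Qed.

Lemma direct_sum0 W U v : direct_sum W U -> W v -> U v -> v = 0.
Proof. by move=> [_ _ WU0 _] Wv Uv; have : (W `&` U) v by []; rewrite WU0. Qed.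

Lemma direct_sum_proj W U : direct_sum W U ->
  exists P : {linear V -> V}, forall v, W (P v) /\ U (v - P v).
Proof.
move=> WU; have [Wmod Umod _ WUT] := WU.
have [_ Wlin] := (submod_closedP W).1 Wmod.
have [U0 Ulin] := (submod_closedP U).1 Umod.
apply: (linear_choice (R := fun v w => W w /\ U (v - w)))
  => [a x y u v [Wu Uu] [Wv Uv]|x|u [Wu]].
- split; first exact: Wlin.
  by rewrite opprD addrACA -scalerN -scalerDr; exact: Ulin.
- by have [w [u [Ww Uu ->]]] := WUT x; exists w; rewrite addrC addKr.
- move=> Uu; apply: (direct_sum0 WU) => //.
  by rewrite -(subKr 0 u); exact: submod_closedB.
Qed.

Lemma range_submod phi : submod_closed [in range phi].
Proof.
apply/submod_closedP; split=> [|a _ _ [u _ <-] [v _ <-]].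
  by exists 0; rewrite ?linear0.
by exists (a *: u + v); rewrite ?linearP.
Qed.

(** With [C] a complement of the kernel and [D] one of the range, [chi y] is the unique [c] in [C]
    such that [y - phi c] lies in [D]: [chi] inverts the bijection from [C] to the range and kills
    [D]. *)
Lemma reflexive_inner_inverse phi : exists chi : {linear V -> V},
  (forall x, phi (chi (phi x)) = phi x) /\ (forall x, chi (phi (chi x)) = chi x).
Proof.
have [|C KC] := @submod_complement [set x | phi x = 0].
  apply/submod_closedP; split=> [|a u v /= u0 v0]; first exact: linear0.
  by rewrite linearP u0 v0 scaler0 addr0.
have [D ID] := submod_complement (range_submod phi).
have [_ Cmod _ KCT] := KC; have [_ Dmod _ IDT] := ID.
have [_ Clin] := (submod_closedP C).1 Cmod.
have [_ Dlin] := (submod_closedP D).1 Dmod.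
have C_inj c : C c -> phi c = 0 -> c = 0.
  by move=> Cc c0; exact: (direct_sum0 KC).
have D_phi x : D (phi x) -> phi x = 0.
  by move=> Dx; apply: (direct_sum0 ID) => //; exists x.
have [chi chiP] : exists chi : {linear V -> V},
    forall y, C (chi y) /\ D (y - phi (chi y)).
  apply: (linear_choice (R := fun y c => C c /\ D (y - phi c)))
    => [a x y u v [Cu Du] [Cv Dv]|y|c [Cc]].
  - split; first exact: Clin.
    by rewrite linearP opprD addrACA -scalerN -scalerDr; exact: Dlin.
  - have [_ [d [[x _ <-] Dd ->]]] := IDT y.
    have [z [c [z0 Cc ->]]] := KCT x.
    by exists c; rewrite linearD z0 add0r addrC addKr.
  - rewrite sub0r -linearN => /D_phi; rewrite linearN => /eqP.
    by rewrite oppr_eq0 => /eqP; exact: C_inj.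
have phiK x : phi (chi (phi x)) = phi x.
  apply/esym/eqP; rewrite -subr_eq0 -linearB; apply/eqP/D_phi.
  by rewrite linearB; exact: (chiP _).2.
exists chi; split=> // x; apply/eqP; rewrite -subr_eq0; apply/eqP/C_inj.
  by apply: submod_closedB => //; exact: (chiP _).1.
by rewrite linearB phiK subrr.
Qed.

(** * Finite spanning families in row-vector coordinates *)

Definition comb n (e : 'I_n -> V) (c : 'rV[k]_n) : V :=
  \sum_(i < n) c 0 i *: e i.

Definition spans n (e : 'I_n -> V) A := A = range (comb e).

Lemma fin_dim_spans A : fin_dim A <-> exists n (e : 'I_n -> V), spans e A.
Proof.
split=> -[n [e ->]]; exists n, e.
  apply/seteqP; split=> [v [c ->]|_ [c _ <-]].
    by exists (\row_i c i) => //; apply: eq_bigr => i _; rewrite mxE.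
  by exists (c 0).
apply/seteqP; split=> [_ [c _ <-]|v [c ->]]; first by exists (c 0).
by exists (\row_i c i) => //; apply: eq_bigr => i _; rewrite mxE.
Qed.

Lemma comb_linear n (e : 'I_n -> V) : linear (comb e).
Proof.
move=> a c d; rewrite /comb scaler_sumr -big_split /=.
by apply: eq_bigr => i _; rewrite !mxE scalerDl scalerA.
Qed.

Lemma comb_mulmx m n (e : 'I_n -> V) (A : 'M_(m, n)) (c : 'rV_m) :
  comb e (c *m A) = comb (fun i => comb e (row i A)) c.
Proof.
rewrite /comb; under eq_bigr do rewrite mxE scaler_suml.
rewrite exchange_big; apply: eq_bigr => i _; rewrite scaler_sumr.
by apply: eq_bigr => j _; rewrite mxE scalerA.
Qed.

Lemma comb_comp phi n (e : 'I_n -> V) c : comb (phi \o e) c = phi (comb e c).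
Proof. by rewrite linear_sum; apply: eq_bigr => i _; rewrite linearZ. Qed.

Lemma spans_remove n (e : 'I_n.+1 -> V) (c : 'rV_n.+1) A :
  spans e A -> c != 0 -> comb e c = 0 -> exists e' : 'I_n -> V, spans e' A.
Proof.
move=> -> /rV0Pn[j cj0] ec0; exists (e \o lift j).
have combE d : comb e d = d 0 j *: e j + comb (e \o lift j) (col' j d).
  rewrite /comb (bigD1_ord j)//=; congr (_ + _).
  by apply: eq_bigr => i _; rewrite mxE.
apply/seteqP; split=> [_ [d _ <-]|_ [d _ <-]].
  (* Subtracting this multiple of the relation [c] cancels the coordinate [j] of [d]. *)
  exists (col' j (d - (d 0 j / c 0 j) *: c)) => //.
  have := comb_linear e (- (d 0 j / c 0 j)) c d.
  rewrite ec0 scaler0 add0r scaleNr addrC combE !mxE mulfVK// subrr.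
  by rewrite scale0r add0r.
pose d' : 'rV_n.+1 := \row_i oapp (d 0) 0 (unlift j i).
exists d' => //; rewrite combE mxE unlift_none scale0r add0r.
by congr comb; apply/rowP => i; rewrite !mxE liftK.
Qed.

(** * The AST decomposition and the index *)

Lemma iter_set_bij phi W n : set_bij W W phi -> set_bij W W (iter n phi).
Proof.
move=> bij; elim: n => [|n IHn]; last exact: set_bij_comp IHn bij.
by split=> // v Wv; exists v.
Qed.

Lemma range_iterS_sub phi n : range (iter n.+1 phi) `<=` range (iter n phi).
Proof. by move=> _ [x _ <-]; exists (phi x); rewrite // -iterSr. Qed.

Lemma range_iterS_image phi n : range (iter n.+1 phi) = phi @` range (iter n phi).
Proof.
apply/seteqP; split=> [_ [x _ <-]|_ [_ [x _ <-] <-]]; last by exists x.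
by exists (iter n phi x) => //; exists x.
Qed.

(* Take the power of [phi] whose range is spanned by the fewest vectors [e i]:
   minimality makes the [phi (e i)] free, so [phi] acts invertibly on [e]. *)
Lemma stable_range phi : finite_potent phi -> exists n,
  fin_dim (range (iter n phi)) /\
  set_bij (range (iter n phi)) (range (iter n phi)) phi.
Proof.
move=> [n0 [_ fin0]].
pose S d := exists n (e : 'I_d -> V), spans e (range (iter n phi)).
have exS : exists d, `[< S d >].
  have [d [e de]] := (fin_dim_spans _).1 fin0.
  by exists d; apply/asboolP; exists n0, e.
have [d /asboolP[n [e en]] dmin] := ex_minnP exS.
exists n; split; first by apply/fin_dim_spans; exists d, e.
have en1 : spans (phi \o e) (range (iter n.+1 phi)).
  rewrite /spans range_iterS_image en; apply/seteqP.
  split=> [_ [_ [c _ <-] <-]|_ [c _ <-]].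
    by exists c => //; rewrite comb_comp.
  by exists (comb e c); [exists c|rewrite comb_comp].
have free c : comb (phi \o e) c = 0 -> c = 0.
  move=> c0; apply/eqP/negPn/negP => cn0.
  case: d => [|d] in e en en1 c c0 cn0 dmin *.
    by case/eqP: cn0; apply/rowP => -[].
  have [e' e'n] := spans_remove en1 cn0 c0.
  by have /dmin : `[< S d >] by [apply/asboolP; exists n.+1, e']; rewrite ltnn.
have phi_e i : exists r, phi (e i) = comb e r.
  have : (range (iter n phi)) (phi (e i)).
    apply: range_iterS_sub; rewrite en1; exists (delta_mx 0 i) => //.
    rewrite /comb (bigD1 i)//= big1 ?addr0 ?mxE ?eqxx ?scale1r// => j ji.
    by rewrite mxE (negPf ji) andbF scale0r.
  by rewrite en => -[r _ <-]; exists r.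
have [r rP] := choice phi_e; pose M := \matrix_i r i.
have phi_comb c : phi (comb e c) = comb e (c *m M).
  rewrite comb_mulmx -comb_comp; apply: eq_bigr => i _.
  by rewrite rowK /= rP.
have Munit : M \in unitmx.
  (* A row of the left kernel of [M] is the coordinate row of a vector killed by [phi], so it is
     zero by [free]. *)
  rewrite -row_free_unit -kermx_eq0; apply/eqP/row_matrixP => i.
  rewrite row0; apply: free; rewrite comb_comp phi_comb.
  have /sub_kermxP-> : (row i (kermx M) <= kermx M)%MS by exact: row_sub.
  by rewrite /comb big1// => j _; rewrite mxE scale0r.
rewrite en; split=> [_ [c _ <-]|_ _ /set_mem[c _ <-] /set_mem[c' _ <-] cc'|_ [c _ <-]].
- by exists (c *m M); rewrite ?phi_comb.
- congr comb; apply/eqP; rewrite -subr_eq0; apply/eqP/free.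
  have := comb_linear (phi \o e) (-1) c' c.
  by rewrite !scaleN1r [- c' + c]addrC => ->; rewrite !comb_comp cc' addNr.
- exists (comb e (c *m invmx M)); first by exists (c *m invmx M).
  by rewrite phi_comb mulmxKV.
Qed.

(** Fitting decomposition: once [phi] is bijective on the range of [phi^n], that range is [W] and
    the kernel of [phi^n] is [U]. *)
Lemma AST_exists phi : finite_potent phi ->
  exists W U, AST_decomposition phi W U.
Proof.
move=> /stable_range[n [Wfin Wbij]].
have [_ Winj Wsurj] := iter_set_bij n Wbij.
pose W := range (iter n phi); pose U := [set v | iter n phi v = 0].
have W0 : W 0 by exists 0; rewrite ?iter_linear0.
exists W, U; split=> //.
- split.
  + apply/submod_closedP; split=> // a _ _ [u _ <-] [v _ <-].
    by exists (a *: u + v); rewrite ?iter_linear.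
  + apply/submod_closedP; split=> [|a u v]; rewrite /U /= ?iter_linear0//.
    by rewrite iter_linear => -> ->; rewrite scaler0 addr0.
  + apply/seteqP; split=> [v [Wv v0]|_ ->]; last by split=> //; exact: iter_linear0.
    by apply: Winj; rewrite ?inE// iter_linear0.
  (* Since [phi^n] maps [W] onto itself, some [w] in [W] has the same image under [phi^n] as [v]. *)
  + move=> v; have [w Ww wv] : (iter n phi @` W) (iter n phi v).
      by apply: Wsurj; exists v.
    exists w, (v - w); split=> //; last by rewrite addrC subrK.
    by rewrite /U /= iter_linearB wv subrr.
- by move=> u; rewrite /U /= -iterSr iterS => ->; rewrite linear0.
- by exists n.
Qed.

Lemma index_exists phi W U : AST_decomposition phi W U ->
  exists m, vanishes_on phi U m /\ is_index phi m.
Proof.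
move=> ast; have [_ _ _ _ [n Un]] := ast.
have exn : exists n, `[< vanishes_on phi U n >] by exists n; apply/asboolP.
have [m /asboolP Um mmin] := ex_minnP exn.
by exists m; split=> //; exists W, U; split=> // j /asboolP/mmin.
Qed.

(** * The minus order *)

Definition minus_inverse phi psi chi : Prop :=
  [/\ forall x, phi (chi (phi x)) = phi x,
      forall x, chi (phi (chi x)) = chi x,
      forall x, phi (chi x) = psi (chi x)
    & forall x, chi (phi x) = chi (psi x)].

Definition minus_le phi psi := exists chi, minus_inverse phi psi chi.

Lemma minus_le_refl phi : minus_le phi phi.
Proof. by have [chi []] := reflexive_inner_inverse phi; exists chi. Qed.

Lemma minus_inverse_factor phi psi chi : minus_inverse phi psi chi ->
  (forall x, phi x = psi (chi (phi x))) /\ (forall x, phi x = phi (chi (psi x))).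
Proof. by move=> [c1 _ c3 c4]; split=> x; rewrite -?c3 -?c4 c1. Qed.

(** Inner inverses of the larger map are inner inverses of the smaller one: [phi eta phi = phi chi
    psi eta psi chi phi = phi chi psi chi phi = phi]. *)
Lemma minus_inverse_inner phi psi chi eta :
  minus_inverse phi psi chi -> (forall x, psi (eta (psi x)) = psi x) ->
  forall x, phi (eta (phi x)) = phi x.
Proof.
move=> chiP e1 x; have [pl pr] := minus_inverse_factor chiP.
by have [_ _ c3 _] := chiP; rewrite [LHS]pr [phi x]pl e1 -pr c3.
Qed.

Lemma minus_le_anti phi psi : minus_le phi psi -> minus_le psi phi -> phi =1 psi.
Proof.
move=> [chi chiP] [eta [e1 e2 e3 e4]] x.
(* [phi = phi eta phi = phi eta psi = psi eta psi = psi]. *)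
by rewrite -(minus_inverse_inner chiP e1) -e4 -e3 e1.
Qed.

Lemma minus_le_trans phi psi theta :
  minus_le phi psi -> minus_le psi theta -> minus_le phi theta.
Proof.
move=> [chi chiP] [eta [e1 e2 e3 e4]].
have phiK := minus_inverse_inner chiP e1.
have [pl pr] := minus_inverse_factor chiP.
exists (eta \o phi \o eta); split=> x /=.
- by rewrite !phiK.
- by rewrite !phiK.
- by rewrite phiK -e3 [phi (eta x)]pl e1.
- by rewrite phiK -e4 [in RHS]pr e1 -pr.
Qed.

(** * From [leGD1] to the minus order and back *)

(** The two GD1 inverses merge into the single witness [chi phi eta]: its left factor [chi] absorbs
    [psi] on the left, its right factor [eta] absorbs [psi] on the right. *)
Lemma minus_le_of_GD1 phi psi : leGD1 phi psi -> minus_le phi psi.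
Proof.
move=> [[chi [c1 [phi1 p1 [_ _ [_ c2]]]] c3] [eta [e1 [phi2 p2 [_ _ [_ e2]]]] e3]].
have chiK x : phi (chi (phi x)) = phi x by rewrite [LHS](c2 (phi x)); exact: p1.
have etaK x : phi (eta (phi x)) = phi x by rewrite [LHS](e2 (phi x)); exact: p2.
exists (chi \o phi \o eta); split=> x /=; rewrite ?(chiK, etaK)//.
- by rewrite -[RHS]c3 /= chiK.
- by have /= <- := e3 x; rewrite etaK.
Qed.

(** With [m] the index, [chi phi] is the identity on the range of [phi^m], where [psi chi = phi chi]
    therefore gives [psi = phi]. *)
Lemma eq_on_core_of_GD1 phi psi : leGD1 phi psi ->
  exists n, forall x, psi (iter n phi x) = iter n.+1 phi x.
Proof.
move=> [[chi [c1 [phi1 p1 [g [g1 [m im gm]] [cg c2]]]] c3] _].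
exists m => x.
have chiP : chi (phi (iter m phi x)) = iter m phi x.
  rewrite [LHS]cg /= -iterS iterSr [LHS]gm /=.
  have {}g1 y : phi (g (phi y)) = phi y by exact: g1.
  (* For positive index, commuting [g] past [phi^m] leaves a factor [phi g phi = phi]. For index 0,
     [U] is zero, so [phi] is injective on [V] and can be cancelled from [phi g phi = phi]. *)
  case: m im {gm} => [|m] [W [U [ast U0 _]]]; last by rewrite !iterSr g1.
  have [[_ _ _ WU] _ [_ inj _] _ _] := ast.
  have WT v : W v by have [w [u [Ww /U0/= -> ->]]] := WU v; rewrite addr0.
  by apply: inj; rewrite ?inE//=; exact: g1.
by rewrite -chiP -[LHS]c3 /= chiP.
Qed.

(** The given [chi0] need not invert [phi] on [W]; its correction [chi] does, and serves as witness
    for both halves of [leGD1]. *)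
Lemma GD1_of_minus_le phi psi n : finite_potent phi -> minus_le phi psi ->
  (forall x, psi (iter n phi x) = iter n.+1 phi x) -> leGD1 phi psi.
Proof.
move=> /AST_exists[W [U ast]] [chi0 [c1 c2 c3 c4]] psiW0.
have [m [Um im]] := index_exists ast.
have [WU _ Wbij Uphi _] := ast; have [Wmod Umod _ _] := WU.
have [Wphi Winj Wsurj] := Wbij.
have psiW w : W w -> psi w = phi w.
  have [_ _ surj] := iter_set_bij n Wbij.
  by move=> /surj[v _ <-]; exact: psiW0.
have [P PP] := direct_sum_proj WU.
have WP v : W (P v) := (PP v).1; have UP v : U (v - P v) := (PP v).2.
have PW w : W w -> P w = w.
  move=> Ww; apply/esym/eqP; rewrite -subr_eq0; apply/eqP.
  by apply: (direct_sum0 WU) => //; exact: submod_closedB.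
have PU u : U u -> P u = 0.
  move=> Uu; apply: (direct_sum0 WU) => //.
  by rewrite -(subKr u (P u)); exact: submod_closedB.
have Pphi v : P (phi v) = phi (P v).
  rewrite -{1}(subrK (P v) v) linearD linearD (PU (phi _)) ?add0r; last exact: Uphi.
  by rewrite PW//; exact: Wphi.
have kerU v : phi v = 0 -> U v.
  (* [P] commutes with [phi], and [phi] is injective on [W], so kernel vectors have no component in
     [W]. *)
  move=> v0; have := UP v; suff -> : P v = 0 by rewrite subr0.
  have phi0 : phi (P v) = 0 by rewrite -Pphi v0 linear0.
  apply: Winj; rewrite ?inE ?phi0 ?linear0//.
  by have [] := (submod_closedP W).1 Wmod.
(* [E] maps [V] onto a complement of [ker phi] which, unlike the range of
   [chi0 phi], contains the core [W]. *)
pose E : {linear V -> V} := P \+ (chi0 \o phi \o (idfun \- P)).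
have EE v : E v = P v + chi0 (phi (v - P v)) by [].
have phiE v : phi (E v) = phi v by rewrite EE [LHS]linearD c1 -linearD addrC subrK.
have psiE v : psi (E v) = phi v.
  by rewrite EE [LHS]linearD -c3 c1 psiW// -linearD addrC subrK.
(* [E] kills [ker phi], which lies in [U]; hence [E v] depends only on [phi v], and
   [chi phi = E chi0 phi = E]. *)
have Eker u v : phi u = phi v -> E u = E v.
  move=> uv; apply/eqP; rewrite -subr_eq0 -linearB EE.
  have uv0 : phi (u - v) = 0 by rewrite linearB uv subrr.
  by rewrite PU ?subr0 ?add0r ?uv0 ?linear0//; exact: kerU.
pose chi : {linear V -> V} := E \o chi0.
have chi_phi v : chi (phi v) = E v by apply: Eker; exact: c1.
have chi_phiW w : W w -> chi (phi w) = w.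
  by move=> Ww; rewrite chi_phi EE PW// subrr !linear0 addr0.
have chi_phiU u : U u -> U (chi (phi u)).
  move=> Uu; rewrite chi_phi -(subrK u (E u)); apply: submod_closedD => //.
  by apply: kerU; rewrite linearB phiE subrr.
(* [g] is a G-Drazin inverse because it preserves both [W] and [U]. *)
pose Q : {linear V -> V} := idfun \- P.
pose g : {linear V -> V} := (chi \o P) \+ (Q \o chi \o Q).
have gE v : g v = chi (P v) + (chi (v - P v) - P (chi (v - P v))) by [].
(* On [U], the map [chi phi] stays inside [U], so the outer [Q] removes nothing there. *)
have g_phi v : g (phi v) = chi (phi v).
  rewrite gE Pphi -(linearB phi) [P (chi _)]PU ?subr0; last exact: chi_phiU.
  by rewrite -!linearD addrC subrK.
have gW w : W w -> g w = chi w.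
  by move=> Ww; rewrite gE PW// subrr !linear0 !addr0.
have phim v : iter m phi v = iter m phi (P v).
  by rewrite -{1}(subrK (P v) v) iter_linearD Um ?add0r.
have phi_chiK v : phi (chi (phi v)) = phi v by rewrite chi_phi phiE.
have GD1chi : invGD1 phi chi.
  split=> [x|]; first by rewrite /= phiE c2.
  exists chi; first exact: phi_chiK.
  exists g; last by split=> // x; exact/esym/g_phi.
  split=> [x|]; first by have := phi_chiK x; rewrite -g_phi.
  (* [phi^m] kills the components in [U]. Writing [P x = phi w] with [w] in [W], both sides become
     [phi^m w]. *)
  exists m => // x; rewrite -[LHS]/(g (iter m phi x)) -[RHS]/(iter m phi (g x)).
  have [Wm _ _] := iter_set_bij m Wbij.
  rewrite phim gW ?gE; last exact: Wm.
  rewrite iter_linearD [X in _ + X]Um ?addr0//; have [w Ww <-] := Wsurj _ (WP x).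
  by rewrite -iterSr iterS !chi_phiW//; exact: Wm.
split; exists chi => // x; rewrite /= ?phiE ?psiE//.
by rewrite c4.
Qed.

End LinearAlgebra.

Theorem theorem4p20 (k : fieldType) (V : lmodType k) :
  [/\ (forall phi : {linear V -> V}, finite_potent phi -> leGD1 phi phi),
      (forall phi psi : {linear V -> V}, finite_potent phi -> finite_potent psi ->
         leGD1 phi psi -> leGD1 psi phi -> phi = psi)
    & (forall phi psi theta : {linear V -> V},
         finite_potent phi -> finite_potent psi -> finite_potent theta ->
         leGD1 phi psi -> leGD1 psi theta -> leGD1 phi theta)].
Proof.
split=> [phi fin|phi psi _ _ pq qp|phi psi theta fin _ _ pq qr].
- exact: (GD1_of_minus_le (n := 0) fin (minus_le_refl phi)).
- by apply/linear_funext/minus_le_anti; exact: minus_le_of_GD1.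
have [m pm] := eq_on_core_of_GD1 pq; have [n pn] := eq_on_core_of_GD1 qr.
have iterE j x : iter j phi (iter m phi x) = iter j psi (iter m phi x).
  by elim: j => //= j <-; rewrite -iterD addnC iterD pm.
apply: (@GD1_of_minus_le _ _ _ _ (n + m) fin) => [|x].
  exact: minus_le_trans (minus_le_of_GD1 pq) (minus_le_of_GD1 qr).
(* [theta phi^(n+m) = theta psi^n phi^m = psi^(n+1) phi^m = phi^(n+1+m)]. *)
by rewrite iterD iterE pn -iterE -iterD.
Qed.
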